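(* Let $G$ be a finite simple connected graph with $\chi(G) = \Delta(G)$, and suppose $G$ is not isomorphic to $\overline{C_7}$. Then $G$ contains either a complete graph $K_{\Delta(G)}$ as a subgraph or a high odd hole.
   Context: $\chi(G)$ denotes the chromatic number and $\Delta(G)$ the maximum degree of $G$. $\overline{C_7}$ is the complement of the cycle on seven vertices. An odd hole in $G$ is an induced (chordless) cycle of odd length at least five. A high odd hole is an odd hole in $G$ in which every vertex has degree at least $\Delta(G)-1$ in $G$. *)

(* Defs.v *)
From mathcomp Require Import all_boot.
Set Implicit Arguments.
Unset Strict Implicit.
Unset Printing Implicit Defensive.

Record sgraph := SGraph {
  svertex :> finType;
  sedge : rel svertex;
  sedge_sym : symmetric sedge;
  sedge_irrefl : irreflexive sedge }.

Arguments sedge {s} x y.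

Definition connected_graph (G : sgraph) : Prop :=
  forall x y : G, connect (@sedge G) x y.

Definition degree (G : sgraph) (x : G) : nat := #|[set y : G | sedge x y]|.

Definition max_degree (G : sgraph) : nat := \max_(x : G) degree x.

Definition proper_coloring (G : sgraph) (k : nat) (c : {ffun G -> 'I_k}) : bool :=
  [forall x : G, forall y : G, sedge x y ==> (c x != c y)].

Definition colorable (G : sgraph) (k : nat) : bool :=
  [exists c : {ffun G -> 'I_k}, proper_coloring c].

Lemma colorable_exists (G : sgraph) : exists k, colorable G k.
Proof.
exists #|G|; apply/existsP; exists [ffun x : G => enum_rank x].
apply/forallP => x; apply/forallP => y; apply/implyP => xy; rewrite !ffunE.
by apply: contraTneq xy => /enum_rank_inj ->; rewrite sedge_irrefl.
Qed.

Definition chromatic_number (G : sgraph) : nat := ex_minn (colorable_exists G).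

Definition isomorphic (G H : sgraph) : Prop :=
  exists2 f : G -> H, bijective f & {mono f : x y / sedge x y}.

Definition contains_subgraph (G H : sgraph) : Prop :=
  exists2 f : H -> G, injective f & {homo f : x y / sedge x y}.

Definition complete_rel (n : nat) : rel 'I_n := fun i j => i != j.

Lemma complete_sym (n : nat) : symmetric (@complete_rel n).
Proof. by move=> i j; rewrite /complete_rel eq_sym. Qed.

Lemma complete_irrefl (n : nat) : irreflexive (@complete_rel n).
Proof. by move=> i; rewrite /complete_rel eqxx. Qed.

Definition complete_graph (n : nat) : sgraph :=
  SGraph (@complete_sym n) (@complete_irrefl n).

(* [ordS] is the successor modulo n.  The guard [i != j] only matters for
   n = 1; this is the cycle C_n for n >= 3. *)
Definition cycle_rel (n : nat) : rel 'I_n :=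
  fun i j => (i != j) && ((ordS i == j) || (ordS j == i)).

Lemma cycle_sym (n : nat) : symmetric (@cycle_rel n).
Proof. by move=> i j; rewrite /cycle_rel eq_sym orbC. Qed.

Lemma cycle_irrefl (n : nat) : irreflexive (@cycle_rel n).
Proof. by move=> i; rewrite /cycle_rel eqxx. Qed.

Definition cycle_graph (n : nat) : sgraph :=
  SGraph (@cycle_sym n) (@cycle_irrefl n).

Definition compl_rel (G : sgraph) : rel G :=
  fun x y => (x != y) && ~~ sedge x y.

Lemma compl_sym (G : sgraph) : symmetric (@compl_rel G).
Proof. by move=> x y; rewrite /compl_rel eq_sym sedge_sym. Qed.

Lemma compl_irrefl (G : sgraph) : irreflexive (@compl_rel G).
Proof. by move=> x; rewrite /compl_rel eqxx. Qed.

Definition compl_graph (G : sgraph) : sgraph :=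
  SGraph (@compl_sym G) (@compl_irrefl G).

(* [{mono ...}] (edges preserved and reflected) makes the cycle induced. *)
Definition odd_hole (G : sgraph) (k : nat) (h : cycle_graph k -> G) : Prop :=
  [/\ odd k, 5 <= k, injective h & {mono h : i j / sedge i j}].

Definition has_high_odd_hole (G : sgraph) : Prop :=
  exists (k : nat) (h : cycle_graph k -> G),
    odd_hole h /\ forall i, (max_degree G).-1 <= degree (h i).

(* Main.v *)
Require Import Defs.
From mathcomp Require Import all_boot zify.
From Stdlib Require Import Classical.

(* Let n = Delta - 1, let U be a minimal set of vertices that is not
   n-colourable, and suppose that U contains no odd hole.  Fix v in U and an
   n-colouring f of U - v.  Two neighbours of v whose colours occur only once
   around v are joined by a Kempe chain; a shortest such chain closes up through
   v to an odd cycle, so the two neighbours are adjacent.  If v has n neighbours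
   in U this gives K_Delta.  Otherwise U is all of G, G is Delta-regular, and N(v)
   consists of two vertices a, b of the same colour and a clique in which each
   vertex sees a or b, where neither a nor b sees the whole clique.  Comparing
   N(v) with N(a) and counting shows that every neighbourhood induces a path on
   four vertices and Delta = 4, so G is locally the square of a cycle
   ..., b, x, v, z, a, v3, v4, v5, ....  The 3-colouring f is then forced along
   this sequence.  If v5 = b, then G is the square of C_7, which is the complement
   of C_7.  Otherwise the Kempe chain from b to a, closed up through v and
   shortened by replacing a, v3, v5, v6 with a, v4, v6, is an odd hole. *)

Set Implicit Arguments.
Unset Strict Implicit.
Unset Printing Implicit Defensive.

(** * Induced paths and odd holes *)

Definition hole_in (G : sgraph) (U : {set G}) : Prop :=
  exists (k : nat) (h : cycle_graph k -> G), odd_hole h /\ forall i, h i \in U.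

Definition induced_rel (G : sgraph) (S : {set G}) : rel G :=
  [rel x y | [&& x \in S, y \in S & sedge x y]].

Lemma cycle_relE k (i j : 'I_k) : i < j ->
  cycle_rel i j = (j == i.+1 :> nat) || ((i == 0 :> nat) && (j.+1 == k)).
Proof.
move=> ij; have jk := ltn_ord j.
rewrite /cycle_rel -!val_eqE /= neq_ltn ij /= modn_small; last by lia.
rewrite eq_sym; congr (_ || _).
have [e|ne] := eqVneq j.+1 k; first by rewrite andbT e modnn eq_sym.
by rewrite andbF modn_small; lia.
Qed.

Section ChordlessPaths.
Variable G : sgraph.
Implicit Types (x y z v s t : G) (p q : seq G) (S U : {set G}).

(** [x :: p] is an induced path: each vertex sees its successor and no later vertex. *)
Fixpoint chordless x p : bool :=
  if p is y :: p' then
    [&& sedge x y, all (fun z => (z != x) && ~~ sedge x z) p' & chordless y p']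
  else true.

(** Jump from [x] straight to the last vertex of [y :: q] that equals [x] or is adjacent to it, and
    keep only what follows; no chord at [x] can remain. *)
Lemma chordless_extend x y q :
  chordless y q -> has (fun z => (z == x) || sedge x z) (y :: q) ->
  exists q', [/\ chordless x q', last x q' = last y q & {subset q' <= y :: q}].
Proof.
elim: q y => [|y2 q IH] y.
  move=> _ /=; rewrite orbF => /orP[/eqP <-|xy].
    by exists [::]; split=> // z; rewrite in_nil.
  by exists [:: y]; split=> //=; rewrite xy.
move=> cyq; have /and3P[yy2 _ cq] := cyq.
have [h2 _|h2] := boolP (has (fun z => (z == x) || sedge x z) (y2 :: q)).
  have [q' [c1 c2 c3]] := IH y2 cq h2; exists q'; split=> // z /c3 zq.
  by rewrite inE zq orbT.
rewrite [has _ (y :: _)]/= -[_ || has _ q]/(has _ (y2 :: q)) (negbTE h2) orbF.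
case/orP=> [/eqP eyx|xy].
  by subst y; exists (y2 :: q); split=> // z zq; rewrite inE zq orbT.
exists (y :: y2 :: q); split=> //.
rewrite -[chordless x _]/[&& sedge x y, all (fun z => (z != x) && ~~ sedge x z) (y2 :: q)
   & chordless y (y2 :: q)] xy cyq andbT /=.
move: h2; rewrite -all_predC => h2; rewrite -[_ && all _ q]/(all _ (y2 :: q)).
by apply: sub_all h2 => z /=; rewrite negb_or.
Qed.

Lemma connect_chordless S s t :
  connect (induced_rel S) s t -> s \in S ->
  exists q, [/\ chordless s q, last s q = t & {subset s :: q <= S}].
Proof.
case/connectP=> p; elim: p s => [|y p IH] s.
  by move=> _ -> sS; exists [::]; split=> // z; rewrite inE => /eqP->.
case/andP=> /and3P[_ yS sy] py tE sS.
have [q [cq lq sq]] := IH y py tE yS.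
have [|q' [c1 c2 c3]] := @chordless_extend s y q cq; first by rewrite /= sy orbT.
exists q'; split=> //; first by rewrite c2.
by move=> z; rewrite inE => /orP[/eqP->//|/c3/sq].
Qed.

Lemma chordless_uniq x p : chordless x p -> uniq (x :: p).
Proof.
elim: p x => [//|y p IH] x /and3P[xy xp cp].
rewrite cons_uniq IH // andbT inE negb_or; apply/andP; split.
  by apply: contraTneq xy => ->; rewrite sedge_irrefl.
by apply/negP => xp'; have := allP xp _ xp'; rewrite eqxx.
Qed.

Lemma chordless_nth x0 x p i j : chordless x p -> i < j <= size p ->
  sedge (nth x0 (x :: p) i) (nth x0 (x :: p) j) = (j == i.+1).
Proof.
elim: p x i j => [|y p IH] x i j; first by rewrite /=; lia.
case/and3P=> xy xp cp; case: j => [|j]; first by lia.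
case: i => [|i]; last by rewrite eqSS ltnS; apply: IH.
case: j => [|j] ij; first by rewrite /= xy.
rewrite /=; apply/negbTE.
by case/andP: (allP xp _ (mem_nth x0 (ij : j < size p))).
Qed.

Lemma chordless_parity (g : G -> bool) S x p :
  {in S &, forall x y, sedge x y -> g x != g y} ->
  {subset x :: p <= S} -> chordless x p -> g (last x p) = g x (+) odd (size p).
Proof.
move=> gS; elim: p x => [|y p IH] x sS /=; first by rewrite addbF.
case/and3P=> xy _ cp; rewrite IH //; last by move=> z zp; rewrite sS // inE zp orbT.
have : g x != g y by apply: gS => //; apply: sS; rewrite !inE eqxx ?orbT.
by case: (g x) (g y) (odd _) => [] [] [].
Qed.

(** The apex [v] sees only the two ends of the induced path, so it closes the path to an induced
    cycle, whose length [size q + 2] is odd and at least five. *)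
Lemma chordless_apex_hole U v s q :
  v \in U -> {subset s :: q <= U} -> v \notin s :: q -> chordless s q ->
  {in s :: q, forall y, sedge v y = (y == s) || (y == last s q)} ->
  odd (size q) -> 3 <= size q -> hole_in U.
Proof.
move=> vU sU vq cq vE oq szq; pose c := v :: s :: q.
have uc : uniq c by rewrite cons_uniq vq chordless_uniq.
have szc : size c = (size q).+2 by [].
exists (size c), (fun i : 'I_(size c) => nth v c i); split; last first.
  move=> i; have := mem_nth v (ltn_ord i); rewrite [in _ -> _]inE.
  by case/orP=> [/eqP->//|/sU].
split=> //; first by rewrite szc /= negbK.
  by move=> i j /eqP; rewrite nth_uniq // => /eqP /val_inj.
have main (i j : 'I_(size c)) : i < j ->
    sedge (nth v c i) (nth v c j) = cycle_rel i j.
  move=> ij; have jc := ltn_ord j.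
  rewrite cycle_relE //.
  (* Index 0 is the apex, and index [i'.+1] is position [i'] on the path. *)
  case: (nat_of_ord i) (nat_of_ord j) ij jc => [|i'] [|j'] // ij jc.
    rewrite [nth v c 0]/= [nth v c _]/= vE; last by rewrite mem_nth.
    rewrite -[X in (X == s)]/(nth v (s :: q) j') -[s in (_ == s)]/(nth v (s :: q) 0).
    rewrite (last_nth v) !nth_uniq ?chordless_uniq //=.
  by rewrite /= -/(nth v (s :: q) i') chordless_nth //= ?orbF; lia.
move=> i j; have [ij|ji|/val_inj->] := ltngtP i j; first exact: main.
  by rewrite sedge_sym main // [RHS](@sedge_sym (cycle_graph _)).
by rewrite !sedge_irrefl.
Qed.

(* Between vertices of opposite sides, a shortest path in the bipartite graph
   G[S] closes up through v to an odd cycle, which is chordless. *)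
Lemma bipartite_link_adj U S v s t (g : G -> bool) :
  ~ hole_in U -> v \in U -> S \subset U -> v \notin S ->
  {in S &, forall x y, sedge x y -> g x != g y} ->
  {in S, forall y, sedge v y = (y == s) || (y == t)} ->
  s \in S -> connect (induced_rel S) s t -> g s != g t -> sedge s t.
Proof.
move=> nh vU SU vS gS vE sS st gst.
have [q [cq lq sq]] := connect_chordless st sS.
have oq : odd (size q).
  have := chordless_parity gS sq cq; rewrite lq => gt.
  by move: gst; rewrite gt; case: (g s); case: (odd _).
(* An odd [size q] below 3 equals 1, and then the path is the edge from [s] to [t] itself. *)
have [szq|szq] := leqP 3 (size q); last first.
  case: q oq szq lq cq {sq} => [|y [|z [|]]] //= _ _ <-.
  by case/andP.
case: nh; apply: (chordless_apex_hole vU _ _ cq _ oq szq).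
- by move=> z /sq; apply/subsetP.
- by apply: contra vS => /sq.
- by move=> y /sq yS; rewrite lq vE.
Qed.
End ChordlessPaths.

(** * Partial colourings and Kempe swaps *)

Definition proper_on (G : sgraph) (n : nat) (U : {set G}) (f : G -> nat) : Prop :=
  {in U, forall x, f x < n} /\ {in U &, forall x y, sedge x y -> f x != f y}.

Definition nbhd (G : sgraph) (U : {set G}) (v : G) : {set G} :=
  [set y in U | sedge v y].

Definition bichromatic (G : sgraph) (W : {set G}) (f : G -> nat) (i j : nat) : {set G} :=
  [set y in W | (f y == i) || (f y == j)].

(** Meant for sets [D] that carry the colours [i] and [j] only, so that one test on [i] decides. *)
Definition kempe_swap (G : sgraph) (f : G -> nat) (i j : nat) (D : {set G}) (y : G) : nat :=
  if y \in D then if f y == i then j else i else f y.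

(** [D] may be any union of Kempe components. An edge leaving [D] ends in a vertex whose colour is
    neither [i] nor [j], and which the swap leaves alone. *)
Lemma kempe_swap_proper (G : sgraph) n (W D : {set G}) f i j :
  proper_on n W f -> i < n -> j < n -> D \subset bichromatic W f i j ->
  (forall y z, y \in D -> z \in bichromatic W f i j -> sedge y z -> z \in D) ->
  proper_on n W (kempe_swap f i j D).
Proof.
move=> [fn fp] ilt jlt /subsetP DB Dcl; split.
  move=> x xW; rewrite /kempe_swap; case: ifP => _; last exact: fn.
  by case: ifP.
have cross x y : x \in W -> y \in W -> x \in D -> y \notin D -> sedge x y ->
    kempe_swap f i j D x != kempe_swap f i j D y.
  move=> xW yW xD yD xy; rewrite /kempe_swap xD (negbTE yD).
  have : y \notin bichromatic W f i j by apply: contra yD => yB; apply: Dcl xy.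
  rewrite inE yW /= negb_or => /andP[yi yj].
  by case: ifP => _; rewrite eq_sym.
move=> x y xW yW xy; case xD: (x \in D); case yD: (y \in D).
- rewrite /kempe_swap xD yD; have := fp _ _ xW yW xy.
  have := DB _ xD; have := DB _ yD; rewrite !inE xW yW !andTb.
  have [->|ji] := eqVneq j i; first by case/orP=> /eqP-> /orP[]/eqP->; rewrite eqxx.
  by case/orP=> /eqP-> /orP[]/eqP->; rewrite !eqxx // ?(negbTE ji) // eq_sym.
- by apply: cross => //; rewrite yD.
- by rewrite eq_sym; apply: cross; rewrite ?xD // sedge_sym.
- by rewrite /kempe_swap xD yD; apply: fp.
Qed.

Lemma bichromatic_bipartite (G : sgraph) n (W : {set G}) f i j : proper_on n W f ->
  {in bichromatic W f i j &, forall x y, sedge x y -> (f x == i) != (f y == i)}.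
Proof.
move=> [_ fp] x y; rewrite !inE => /andP[xW xc] /andP[yW yc] xy.
have := fp _ _ xW yW xy.
case: (eqVneq (f x) i) xc => [->|_] /= xc; case: (eqVneq (f y) i) yc => [->|_] //= yc.
by rewrite (eqP xc) (eqP yc) eqxx.
Qed.

Definition singly_colored (G : sgraph) (U : {set G}) (f : G -> nat) (v x : G) : Prop :=
  x \in nbhd U v /\ {in nbhd U v, forall y, f y = f x -> y = x}.

(** Pigeonhole: at most [n] elements that show all [n] colours show each of them once. *)
Lemma surjective_coloring_inj (T : finType) (N : {set T}) n (f : T -> nat) :
  (forall i, i < n -> exists2 x, x \in N & f x = i) -> #|N| <= n ->
  {in N &, injective f}.
Proof.
move=> fs Nn; apply/dinjectiveP.
apply: (@leq_size_uniq _ (iota 0 n)); first exact: iota_uniq.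
  move=> i; rewrite mem_iota => /fs[x xN <-]; apply: map_f.
  by rewrite mem_enum.
by rewrite size_map size_iota -cardE.
Qed.

Definition clique (G : sgraph) (K : {set G}) : Prop :=
  {in K &, forall x y, x != y -> sedge x y}.

Definition has_clique (G : sgraph) (m : nat) : Prop :=
  exists2 K : {set G}, clique K & #|K| = m.

Lemma clique_setU1 (G : sgraph) (K : {set G}) v :
  {in K, forall x, sedge v x} -> clique K -> clique (v |: K).
Proof.
move=> vK cK x y /setU1P[->|xK] /setU1P[->|yK]; rewrite ?eqxx // => xy.
- exact: vK.
- by rewrite sedge_sym vK.
- exact: cK.
Qed.

(* The complement of G[N(v)] is a double star with centres a, b, both having a
   leaf, together with isolated vertices. *)
Record double_star (G : sgraph) (U : {set G}) (v a b : G) : Prop := DoubleStar {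
  ds_a : a \in nbhd U v;
  ds_b : b \in nbhd U v;
  ds_neq : a != b;
  ds_nadj : ~~ sedge a b;
  ds_clique : clique (nbhd U v :\: [set a; b]);
  ds_dom : {in nbhd U v :\: [set a; b], forall x, sedge x a || sedge x b};
  ds_leaf_a : exists2 x, x \in nbhd U v :\: [set a; b] & ~~ sedge x a;
  ds_leaf_b : exists2 x, x \in nbhd U v :\: [set a; b] & ~~ sedge x b }.

(** * Kempe chains around a vertex of a critical set *)

Section CriticalSet.
Variables (G : sgraph) (n : nat) (U : {set G}).
Hypothesis uncolorable : forall f, ~ proper_on n U f.
Hypothesis noHole : ~ hole_in U.
Implicit Types (v x y z a b : G) (f : G -> nat) (S D : {set G}).

Lemma nbhd_sub_del v x : x \in nbhd U v -> x \in U :\ v.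
Proof.
rewrite !inE => /andP[-> vx]; rewrite andbT.
by apply: contraTneq vx => ->; rewrite sedge_irrefl.
Qed.

(** Otherwise colour [i] would be free for [v], and [U] would be [n]-colourable. *)
Lemma nbhd_meets_color v f i : proper_on n (U :\ v) f -> i < n ->
  exists2 x, x \in nbhd U v & f x = i.
Proof.
move=> [fn fp] ilt; have [/existsP[x /andP[xN /eqP fx]]|/existsPn none] :=
  boolP [exists x, (x \in nbhd U v) && (f x == i)]; first by exists x.
case: (uncolorable (f := fun y => if y == v then i else f y)); split.
  by move=> x xU; case: eqVneq => // xv; apply: fn; rewrite !inE xv.
move=> x y xU yU xy; case: (eqVneq x v) => [xv|xv]; case: (eqVneq y v) => [yv|yv].
- by move: xy; rewrite xv yv sedge_irrefl.
- by have := none y; rewrite inE yU -xv xy eq_sym.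
- by have := none x; rewrite inE xU -yv sedge_sym xy.
- by apply: fp => //; rewrite !inE ?xv ?yv.
Qed.

Lemma nbhd_card_ge v f : proper_on n (U :\ v) f -> n <= #|nbhd U v|.
Proof.
move=> fP; have sub : {subset iota 0 n <= map f (enum (nbhd U v))}.
  move=> i; rewrite mem_iota => /(nbhd_meets_color fP)[x xN <-].
  by apply: map_f; rewrite mem_enum.
by have := uniq_leq_size (iota_uniq 0 n) sub; rewrite size_iota size_map -cardE.
Qed.

(** After the swap on [D] some neighbour of [v] must still have colour [f x]. The only old one, [x],
    lies in [D], so the vertex found has been swapped as well and had colour [j] before. *)
Lemma kempe_component_meets v f x j (D : {set G}) :
  proper_on n (U :\ v) f -> j < n -> singly_colored U f v x -> x \in D ->
  D \subset bichromatic (U :\ v) f (f x) j ->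
  (forall y z, y \in D -> z \in bichromatic (U :\ v) f (f x) j -> sedge y z -> z \in D) ->
  exists y, [/\ y \in nbhd U v, y \in D & f y = j].
Proof.
move=> fP jn [xN xu] xD DB Dcl.
have fxn : f x < n by apply: fP.1; apply: nbhd_sub_del.
have fP' := kempe_swap_proper fP fxn jn DB Dcl.
have [y yN] := nbhd_meets_color fP' fxn.
rewrite /kempe_swap; case: ifP => [yD|yD /(xu _ yN) yx]; last by rewrite yx xD in yD.
have := subsetP DB _ yD; rewrite inE => /andP[_].
(* If [f y = f x], the swapped colour of [y] is [j], which forces [j = f x]. *)
have [fyx _ jfx|_ /= /eqP fy _] := eqVneq (f y) (f x); last by exists y.
by exists y; split=> //; rewrite fyx jfx.
Qed.

Definition component S x : {set G} := [set y in S | connect (induced_rel S) x y].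

Lemma component_closed S x y z :
  y \in component S x -> z \in S -> sedge y z -> z \in component S x.
Proof.
rewrite !inE => /andP[yS xy] zS yz; rewrite zS.
by apply: connect_trans xy (connect1 _); rewrite /induced_rel /= yS zS.
Qed.

(** The Kempe component of [x] in the colours of [x] and [y] meets the neighbours of [v] of colour
    [f y], that is, it contains [y]. Since [v] sees only [x] and [y] among these colours,
    [bipartite_link_adj] applies. *)
Lemma singly_colored_adj v f x y : v \in U -> proper_on n (U :\ v) f ->
  singly_colored U f v x -> singly_colored U f v y -> x != y -> sedge x y.
Proof.
move=> vU fP xs ys xy.
have [xN xu] := xs; have [yN yu] := ys.
have xW := nbhd_sub_del xN; have yW := nbhd_sub_del yN.
pose S := bichromatic (U :\ v) f (f x) (f y).
have xS : x \in S by rewrite inE xW eqxx.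
have [] := @kempe_component_meets v f x (f y) (component S x) fP (fP.1 _ yW) xs.
- by rewrite inE xS connect0.
- by apply/subsetP=> z; rewrite inE => /andP[].
- by move=> *; apply: component_closed; eassumption.
move=> y' [y'N y'D /(yu _ y'N) ey]; subst y'.
have fxy : f x != f y by apply: contra xy => /eqP /(yu _ xN) ->.
apply: (@bipartite_link_adj G U S v x y (fun z => f z == f x)) => //.
- by apply/subsetP=> z; rewrite !inE => /andP[/andP[]].
- by rewrite !inE eqxx.
- exact: bichromatic_bipartite fP.
- move=> z; rewrite 3!inE => /andP[/andP[zv zU] zc].
  apply/idP/orP => [vz|[]/eqP->]; last 2 first.
    by move: xN; rewrite inE => /andP[].
    by move: yN; rewrite inE => /andP[].
  have zN : z \in nbhd U v by rewrite inE zU.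
  by case/orP: zc => /eqP; [move/(xu _ zN)->; left|move/(yu _ zN)->; right].
- by move: y'D; rewrite inE => /andP[].
- by rewrite eqxx eq_sym eqb_id eq_sym.
Qed.

(** Suppose that [x] sees neither [a] nor [b]. A chain from [x] that reaches one of them before the
    other would force an edge by [bipartite_link_adj]. So the component of [x] without [a] and [b]
    is already closed in the two colours, yet contains no neighbour of [v] coloured [f a], against
    [kempe_component_meets]. *)
Lemma singly_colored_adj_pair v f x a b : v \in U -> proper_on n (U :\ v) f ->
  singly_colored U f v x -> a \in nbhd U v -> b \in nbhd U v ->
  a != x -> b != x -> a != b -> f a = f b ->
  {in nbhd U v, forall y, f y = f a -> y = a \/ y = b} -> sedge x a || sedge x b.
Proof.
move=> vU fP xs aN bN ax bx ab fab abu.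
have [xN xu] := xs.
have xW := nbhd_sub_del xN; have aW := nbhd_sub_del aN; have bW := nbhd_sub_del bN.
have fxa : f x != f a by apply: contra ax => /eqP /esym /(xu _ aN) ->.
pose S := bichromatic (U :\ v) f (f x) (f a).
have SU : S \subset U by apply/subsetP=> z; rewrite !inE => /andP[/andP[]].
have vS : v \notin S by rewrite !inE eqxx.
(* a' and b' are a and b in either order: v has only the neighbours x, a' in S :\ b'. *)
have link a' b' : a' \in nbhd U v -> x != b' -> a' != b' -> f a' = f a ->
    {in nbhd U v, forall y, f y = f a -> y = a' \/ y = b'} ->
    connect (induced_rel (S :\ b')) x a' -> sedge x a'.
  move=> a'N xb' a'b' fa' abu' xa'.
  apply: (@bipartite_link_adj G U (S :\ b') v x a' (fun z => f z == f x)) => //.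
  - by apply/subsetP=> z /setD1P[_] /(subsetP SU).
  - by rewrite inE (negbTE vS) andbF.
  - by move=> z1 z2 /setD1P[_ z1S] /setD1P[_ z2S]; apply: bichromatic_bipartite fP _ _ z1S z2S.
  - move=> z /setD1P[zb']; rewrite 3!inE => /andP[/andP[zv zU] zc].
    apply/idP/orP => [vz|[]/eqP->]; last 2 first.
      by move: xN; rewrite inE => /andP[].
      by move: a'N; rewrite inE => /andP[].
    have zN : z \in nbhd U v by rewrite inE zU.
    case/orP: zc => /eqP; first by move/(xu _ zN)->; left.
    by case/(abu' _ zN)=> ze; [rewrite ze; right|rewrite ze eqxx in zb'].
  - by rewrite in_setD1 xb' inE xW eqxx.
  - by rewrite eqxx eq_sym eqb_id fa' eq_sym.
have [//|/norP[nxa nxb]] := boolP (_ || _).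
have [] := @kempe_component_meets v f x (f a) (component (S :\: [set a; b]) x) fP (fP.1 _ aW) xs.
- by rewrite inE connect0 in_setD in_set2 !(eq_sym x) (negbTE ax) (negbTE bx) inE xW eqxx.
- by apply/subsetP=> z; rewrite inE => /andP[/setDP[]].
- move=> y z yD zS yz.
  have hit c c' : [set a; b] = [set c; c'] -> c != c' -> z = c ->
      connect (induced_rel (S :\ c')) x c.
    move=> abE cc' zc; subst z; move: yD; rewrite abE inE => /andP[yS xy].
    apply: (@connect_trans _ _ y); last apply: connect1.
      apply: connect_sub xy => z1 z2 /and3P[z1S z2S z12]; apply: connect1.
      move: z1S z2S; rewrite /induced_rel /= z12 !in_setD !in_set2 !in_set1.
      by rewrite !negb_or -!andbA => /and3P[_ -> ->] /and3P[_ -> ->].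
    rewrite /induced_rel /= yz [c \in _]in_setD1 cc' zS !andbT.
    by move: yS; rewrite in_setD in_set2 negb_or in_setD1 -andbA => /and3P[_ -> ->].
  apply: component_closed yD _ yz; rewrite in_setD -/S zS andbT in_set2.
  apply/negP=> /orP[]/eqP zc.
    case/negP: nxa; apply: (link a b) => //; first by rewrite eq_sym.
    exact: hit.
  case/negP: nxb; apply: (link b a) => //; rewrite 1?eq_sym //.
    by move=> u uN /(abu _ uN)[->|->]; [right|left].
  by apply: hit; rewrite 1?eq_sym // setUC.
move=> y [yN yD /(abu _ yN) yab]; move: yD; rewrite !inE.
by case: yab => ->; rewrite eqxx ?orbT.
Qed.

(** With at most [n] neighbours every colour around [v] occurs once, so all neighbours are singly
    coloured and pairwise adjacent. *)
Lemma low_degree_clique v f : v \in U -> proper_on n (U :\ v) f -> #|nbhd U v| <= n ->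
  has_clique G n.+1.
Proof.
move=> vU fP dv.
have finj : {in nbhd U v &, injective f}.
  by apply: surjective_coloring_inj dv => i; apply: nbhd_meets_color fP.
have dE : #|nbhd U v| = n by apply/eqP; rewrite eqn_leq dv (nbhd_card_ge fP).
have vN : v \notin nbhd U v by rewrite inE sedge_irrefl andbF.
exists (v |: nbhd U v); last by rewrite cardsU1 vN dE.
apply: clique_setU1 => [x|x y xN yN]; first by rewrite inE => /andP[].
by apply: (singly_colored_adj vU fP); split=> // z zN; apply: finj.
Qed.

(** Exactly one colour repeats around [v], on [a] and [b]; all other neighbours are singly coloured.
    If [a] or [b] saw all of them, it would form a clique of size [n.+1] with them and [v]. *)
Lemma high_degree_double_star v f : v \in U -> proper_on n (U :\ v) f ->
  #|nbhd U v| = n.+1 -> ~ has_clique G n.+1 ->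
  exists a b, double_star U v a b /\ f a = f b.
Proof.
move=> vU fP dv ncl.
have sub : {subset map f (enum (nbhd U v)) <= iota 0 n}.
  move=> i /mapP[x]; rewrite mem_enum => xN ->.
  by rewrite mem_iota; apply: fP.1; apply: nbhd_sub_del.
have /dinjectivePn[b bN [a /andP[/= ab aN] fab]] : ~~ dinjectiveb f (nbhd U v).
  apply/negP=> uf; have := uniq_leq_size uf sub.
  by rewrite size_iota size_map -cardE dv ltnn.
(* Deleting [b] loses no colour, because [a] has the same one; the remaining [n] neighbours are then
   coloured injectively. *)
have fs i : i < n -> exists2 x, x \in nbhd U v :\ b & f x = i.
  move=> /(nbhd_meets_color fP)[x xN fx].
  have [xb|xb] := eqVneq x b; last by exists x; rewrite // !inE xb; rewrite inE in xN.
  by exists a; [rewrite in_setD1 ab|rewrite -fab -xb].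
have finj : {in nbhd U v :\ b &, injective f}.
  by apply: surjective_coloring_inj fs _; have := cardsD1 b (nbhd U v); rewrite bN dv; lia.
have aN' : a \in nbhd U v :\ b by rewrite in_setD1 ab.
have abu : {in nbhd U v, forall y, f y = f a -> y = a \/ y = b}.
  move=> y yN fy; have [->|yb] := eqVneq y b; first by right.
  by left; apply: finj => //; rewrite in_setD1 yb.
pose Q := nbhd U v :\: [set a; b].
have QE x : (x \in Q) = [&& x \in nbhd U v, x != a & x != b].
  by rewrite in_setD in_set2 negb_or andbC.
have xs x : x \in Q -> singly_colored U f v x.
  rewrite QE => /and3P[xN xa xb]; split=> // y yN fy.
  have [yb|yb] := eqVneq y b.
    by case/eqP: xa; apply: finj => //; rewrite ?in_setD1 ?xb // -fy yb.
  by apply: finj => //; rewrite in_setD1 ?yb ?xb.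
have Qcl : {in Q &, forall x y, x != y -> sedge x y}.
  by move=> x y /xs sx /xs sy; apply: (singly_colored_adj vU fP).
have Qcard : #|Q|.+2 = n.+1.
  rewrite -dv -(cardsID [set a; b] (nbhd U v)) (setIidPr _) ?cards2 ?ab //.
  by apply/subsetP=> y /set2P[]->.
have complete c : c \in nbhd U v -> c \in [set a; b] -> {in Q, forall x, sedge x c} -> False.
  move=> cN cab Qc; apply: ncl; exists (v |: (c |: Q)).
    apply: clique_setU1 => [x /setU1P[->|]|]; rewrite ?QE; last first.
    - by apply: clique_setU1 => // x xQ; rewrite sedge_sym Qc.
    - by case/and3P; rewrite inE => /andP[].
    - by move: cN; rewrite inE => /andP[].
  have vN : v \notin nbhd U v by rewrite inE sedge_irrefl andbF.
  have cv : c != v by apply: contraNneq vN => cv; rewrite -{1}cv.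
  rewrite cardsU1 in_setU1 eq_sym (negbTE cv) QE (negbTE vN) cardsU1.
  by rewrite in_setD cab /= -Qcard.
have ex c : c \in nbhd U v -> c \in [set a; b] -> exists2 x, x \in Q & ~~ sedge x c.
  move=> cN cab; apply/exists_inP; rewrite -negb_forall_in.
  by apply/negP=> /forall_inP Qc; apply: complete Qc.
exists a, b; split=> //; split=> //.
- by apply/negP=> /(fP.2 _ _ (nbhd_sub_del aN) (nbhd_sub_del bN)); rewrite fab eqxx.
- move=> x xQ; have := xQ; rewrite QE => /and3P[xN xa xb].
  by apply: (singly_colored_adj_pair vU fP (xs _ xQ)) => //; rewrite eq_sym.
- by apply: ex; rewrite // !inE eqxx.
- by apply: ex; rewrite // !inE eqxx orbT.
Qed.

End CriticalSet.

(** * Regular graphs in which every neighbourhood is the complement of a double star *)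

Lemma double_star_sym (G : sgraph) (U : {set G}) v a b :
  double_star U v a b -> double_star U v b a.
Proof.
case=> aN bN ab nab cl dom la lb.
by split; rewrite 1?[[set b; a]]setUC // 1?eq_sym 1?sedge_sym // => x /dom; rewrite orbC.
Qed.

(** N(v) induces the path p0 p1 p2 p3; distinctness of the four vertices follows from the pattern of
    edges. *)
Record path_nbhd (G : sgraph) (v p0 p1 p2 p3 : G) : Prop := PathNbhd {
  pn_mem : forall y, sedge v y = (y \in [:: p0; p1; p2; p3]);
  pn_adj : [/\ sedge p0 p1, sedge p1 p2 & sedge p2 p3];
  pn_nadj : [/\ ~~ sedge p0 p2, ~~ sedge p0 p3 & ~~ sedge p1 p3] }.

Section RegularDoubleStars.
Variables (G : sgraph) (n : nat).
Local Notation N := (nbhd [set: G]).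
Hypothesis deg : forall u : G, #|N u| = n.+1.
Hypothesis star : forall u : G, exists a b, double_star [set: G] u a b.
Implicit Types (v a b x z w q : G).

Lemma in_nbhdT v y : (y \in N v) = sedge v y.
Proof. by rewrite !inE. Qed.

(** Inside N(v), [a] misses itself, [b] and all of [X], so of its [n.+1] neighbours at most
    [n - #|X|] lie in N(v) together with [v]. *)
Lemma double_star_outside_card v a b (X : {set G}) : double_star [set: G] v a b ->
  X \subset N v :\: [set a; b] -> {in X, forall x, ~~ sedge x a} ->
  #|X| < #|N a :\: (v |: N v)|.
Proof.
move=> ds XQ Xa; have va := ds_a ds; have vb := ds_b ds.
pose Y := a |: (b |: X).
have XQ' x : x \in X -> [/\ x \in N v, x != a & x != b].
  by move/(subsetP XQ)/setDP=> []; rewrite in_set2 negb_or => ? /andP[].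
have Ycard : #|Y| = #|X|.+2.
  rewrite /Y !cardsU1 in_setU1 (negbTE (ds_neq ds)) /=.
  have [/XQ'[]|_] := boolP (a \in X); first by rewrite eqxx.
  by have [/XQ'[]|_] := boolP (b \in X); first by rewrite eqxx.
have YN : Y \subset N v.
  by apply/subsetP=> y /setU1P[->//|/setU1P[->//|/XQ'[]]].
have sub : N a :&: (v |: N v) \subset v |: (N v :\: Y).
  apply/subsetP=> y /setIP[]; rewrite in_nbhdT => ay /setU1P[->|yN]; first by rewrite setU11.
  rewrite setU1r // in_setD yN andbT; apply/negP=> /setU1P[ya|/setU1P[yb|yX]].
  - by move: ay; rewrite ya sedge_irrefl.
  - by move: ay; rewrite yb (negbTE (ds_nadj ds)).
  - by have := Xa _ yX; rewrite sedge_sym ay.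
have := subset_leq_card sub.
have := cardsID (v |: N v) (N a); have := cardsID Y (N v).
rewrite (setIidPr YN) Ycard !deg cardsU1.
by move: #|N a :&: _| #|N a :\: _| #|N v :\: Y| #|X| (v \notin _) => k1 k2 k3 k4 [] /=; clear; lia.
Qed.

(** At least two neighbours of [a] lie outside N(v). If [v] were in the clique part of N(a), these
    two would have to be the centres there, and [v] would see neither of them, against [ds_dom]. *)
Lemma double_star_center v a b : double_star [set: G] v a b ->
  exists q, double_star [set: G] a v q.
Proof.
move=> ds; have [x xQ xa] := ds_leaf_a ds.
have : 1 < #|N a :\: (v |: N v)|.
  rewrite -(cards1 x); apply: double_star_outside_card ds _ _; first by rewrite sub1set.
  by move=> y /set1P->.
case/card_gt1P=> w1 [w2 []]; rewrite !in_setD !in_setU1 !in_nbhdT !negb_or.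
move=> /andP[/andP[w1v vw1] aw1] /andP[/andP[w2v vw2] aw2] w12.
have av : v \in N a by rewrite in_nbhdT sedge_sym -in_nbhdT (ds_a ds).
have [p [q pq]] := star a.
have [vpq|vpq] := boolP (v \in [set p; q]).
  case/set2P: vpq => e; first by subst p; exists q.
  by subst q; exists p; apply: double_star_sym.
have vQ : v \in N a :\: [set p; q] by rewrite in_setD vpq.
have far w : sedge a w -> ~~ sedge v w -> w != v -> w \in [set p; q].
  move=> aw vw wv; apply: contraNT vw => wpq.
  by apply: (ds_clique pq) => //; rewrite ?in_setD ?wpq ?in_nbhdT // eq_sym.
have := ds_dom pq vQ; move: w12 (vw1) (vw2).
by case/set2P: (far _ aw1 vw1 w1v) => ->; case/set2P: (far _ aw2 vw2 w2v) => ->;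
  rewrite ?eqxx // => _ /negbTE-> /negbTE->.
Qed.

(** Two such vertices give [a] three neighbours outside N(v). A vertex [z] that misses [b] sees [a],
    hence at least two of these three by the clique part of N(a). It also sees [v] and all of N(v)
    except [b] and itself, which makes at least [n + 2] neighbours. *)
Lemma double_star_nadj_uniq v a b x x' : double_star [set: G] v a b ->
  x \in N v :\: [set a; b] -> x' \in N v :\: [set a; b] ->
  ~~ sedge x a -> ~~ sedge x' a -> x = x'.
Proof.
move=> ds xQ x'Q xa x'a; apply/eqP/negPn/negP=> xx'.
have [q dsa] := double_star_center ds.
have W3 : 2 < #|N a :\: (v |: N v)|.
  have <- : #|[set x; x']| = 2 by rewrite cards2 xx'.
  apply: double_star_outside_card ds _ _; first by apply/subsetP=> y /set2P[]->.
  by move=> y /set2P[]->.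
have [z zQ zb] := ds_leaf_b ds.
have za : sedge z a by have := ds_dom ds zQ; rewrite (negbTE zb) orbF.
move: (zQ); rewrite in_setD in_set2 negb_or => /andP[/andP[z_a z_b] zN].
have vz : sedge v z by rewrite -in_nbhdT.
have W2 : 1 < #|(N a :\: (v |: N v)) :\ q|.
  have := cardsD1 q (N a :\: (v |: N v)); move: W3.
  by move: #|_ :\ q| #|_| (q \in _) => k m [] /=; clear; lia.
pose Y := v |: (N v :\: [set b; z]).
have Ycard : #|Y| = n.
  rewrite cardsU1 in_setD in_nbhdT sedge_irrefl andbF /=.
  have := cardsID [set b; z] (N v); rewrite deg (setIidPr _).
    by rewrite cards2 eq_sym z_b add2n => -[].
  by apply/subsetP=> y /set2P[]->//; apply: ds_b ds.
have YN : Y \subset N z.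
  apply/subsetP=> y /setU1P[->|]; first by rewrite in_nbhdT sedge_sym.
  rewrite in_setD in_set2 negb_or => /andP[/andP[yb yz] yN].
  have [->|ya] := eqVneq y a; first by rewrite in_nbhdT.
  rewrite in_nbhdT; apply: (ds_clique ds) => //; last by rewrite eq_sym.
  by rewrite in_setD in_set2 negb_or ya yb yN.
have WN : (N a :\: (v |: N v)) :\ q \subset N z.
  apply/subsetP=> w; rewrite in_setD1 in_setD in_setU1 negb_or => /and3P[wq /andP[wv wN] aw].
  rewrite in_nbhdT; apply: (ds_clique dsa); last by apply: contraNneq wN => <-.
    rewrite in_setD in_set2 negb_or in_nbhdT sedge_sym za andbT.
    apply/andP; split; first by apply: contraTneq vz => ->; rewrite sedge_irrefl.
    by apply: contraTneq vz => ->; rewrite (negbTE (ds_nadj dsa)).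
  by rewrite in_setD in_set2 negb_or wv wq aw.
have dis : [disjoint Y & (N a :\: (v |: N v)) :\ q].
  rewrite -setI_eq0; apply/eqP/setP=> y; rewrite !inE.
  by case: (y == v); case: (sedge v y); rewrite /= ?andbF.
have : #|Y :|: (N a :\: (v |: N v)) :\ q| <= n.+1.
  by rewrite -(deg z) subset_leq_card // subUset YN.
by rewrite cardsU (disjoint_setI0 dis) cards0 Ycard; move: #|_ :\ q| W2; clear; lia.
Qed.

(** Such a [c] sees [v] and all of N(v) except itself, which exhausts its degree. But it lies in the
    clique part of N(a), and so it also sees a neighbour of [a] outside N(v). *)
Lemma double_star_no_center v a b c : double_star [set: G] v a b ->
  c \in N v :\: [set a; b] -> sedge c a -> sedge c b -> False.
Proof.
move=> ds cQ ca cb; have [q dsa] := double_star_center ds.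
have [x xQ xa] := ds_leaf_a ds.
have W2 : 1 < #|N a :\: (v |: N v)|.
  rewrite -(cards1 x); apply: double_star_outside_card ds _ _; first by rewrite sub1set.
  by move=> y /set1P->.
move: (cQ); rewrite in_setD in_set2 negb_or => /andP[/andP[c_a c_b] cN].
have vc : sedge v c by rewrite -in_nbhdT.
have [w] : exists w, w \in (N a :\: (v |: N v)) :\ q.
  apply/card_gt0P; have := cardsD1 q (N a :\: (v |: N v)); move: W2.
  by move: #|_ :\ q| #|_| (q \in _) => k m [] /=; clear; lia.
rewrite in_setD1 in_setD in_setU1 negb_or => /and3P[wq /andP[wv wN] aw].
have cw : sedge c w.
  apply: (ds_clique dsa); last by apply: contraNneq wN => <-.
    rewrite in_setD in_set2 negb_or in_nbhdT sedge_sym ca andbT.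
    apply/andP; split; first by apply: contraTneq vc => ->; rewrite sedge_irrefl.
    by apply: contraTneq vc => ->; rewrite (negbTE (ds_nadj dsa)).
  by rewrite in_setD in_set2 negb_or wv wq aw.
have YN : v |: (N v :\ c) \subset N c.
  apply/subsetP=> y /setU1P[->|]; first by rewrite in_nbhdT sedge_sym.
  rewrite in_setD1 => /andP[yc yN].
  have [->|ya] := eqVneq y a; first by rewrite in_nbhdT.
  have [->|yb] := eqVneq y b; first by rewrite in_nbhdT.
  rewrite in_nbhdT; apply: (ds_clique ds) => //; last by rewrite eq_sym.
  by rewrite in_setD in_set2 negb_or ya yb yN.
have : v |: (N v :\ c) == N c.
  rewrite eqEcard YN deg cardsU1 in_setD1 in_nbhdT sedge_irrefl andbF /=.
  by have := cardsD1 c (N v); rewrite cN deg => -> .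
move/eqP/setP/(_ w); rewrite [RHS]in_nbhdT cw in_setU1 in_setD1 (negbTE wv).
by rewrite (negbTE wN) andbF.
Qed.

(** By [ds_dom] and [double_star_no_center] each vertex of the clique part misses exactly one
    centre, and each centre is missed exactly once. So the clique part is a single edge. *)
Lemma double_star_path_nbhd v a b : double_star [set: G] v a b ->
  n = 3 /\ exists x z, path_nbhd v b x z a.
Proof.
move=> ds; have [x xQ xa] := ds_leaf_a ds; have [z zQ zb] := ds_leaf_b ds.
have xb : sedge x b by have := ds_dom ds xQ; rewrite (negbTE xa).
have za : sedge z a by have := ds_dom ds zQ; rewrite (negbTE zb) orbF.
have xz : x != z by apply: contraNneq zb => <-.
have ds' := double_star_sym ds.
have NE y : sedge v y = (y \in [:: b; x; z; a]).
  apply/idP/idP; last first.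
    rewrite !inE => /or4P[]/eqP->; rewrite -in_nbhdT ?(ds_a ds) ?(ds_b ds) //.
      by case/setDP: xQ.
    by case/setDP: zQ.
  move=> vy; rewrite !inE; have [->//|yb] := eqVneq y b.
  have [->|ya] := eqVneq y a; first by rewrite !orbT.
  have yQ : y \in N v :\: [set a; b] by rewrite in_setD in_set2 negb_or ya yb in_nbhdT.
  have [ya'|ya'] := boolP (sedge y a); last first.
    by rewrite (double_star_nadj_uniq ds yQ xQ ya' xa) eqxx.
  have [yb'|yb'] := boolP (sedge y b); first by case: (double_star_no_center ds yQ).
  rewrite (double_star_nadj_uniq ds' _ _ yb' zb) ?eqxx ?orbT // setUC //.
have p : path_nbhd v b x z a.
  have bx : sedge b x by rewrite sedge_sym.
  have bz : ~~ sedge b z by rewrite sedge_sym.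
  have ba : ~~ sedge b a by rewrite sedge_sym (ds_nadj ds).
  by split=> //; split=> //; apply: (ds_clique ds).
split; last by exists x, z.
have : #|N v| = size [:: b; x; z; a].
  rewrite -(card_uniqP _); first by apply: eq_card => y; rewrite in_nbhdT NE.
  rewrite /= !inE !negb_or xz.
  case/setDP: xQ => _; rewrite in_set2 negb_or => /andP[x_a x_b].
  case/setDP: zQ => _; rewrite in_set2 negb_or => /andP[z_a z_b].
  by rewrite x_a z_a ![b == _]eq_sym x_b z_b (ds_neq ds).
by rewrite deg => -[].
Qed.
End RegularDoubleStars.

(** * Graphs in which every neighbourhood is a path on four vertices *)

Lemma connected_closed_full (G : sgraph) (A : {set G}) x :
  connected_graph G -> x \in A -> (forall y z, y \in A -> sedge y z -> z \in A) ->
  A = [set: G].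
Proof.
move=> Gc xA Acl; apply/setP=> y; rewrite inE.
have /connectP[p pP ->] := Gc x y.
by elim: p x xA pP {y} => [//|z p IH] x xA /= /andP[xz]; apply/IH/Acl/xz.
Qed.

Section PathNbhds.
Variable G : sgraph.
Implicit Types (v w p q x z a b y : G).

Lemma sedge_neq x y : sedge x y -> x != y.
Proof. by apply: contraTneq => ->; rewrite sedge_irrefl. Qed.

Lemma path_nbhd_rev v p0 p1 p2 p3 :
  path_nbhd v p0 p1 p2 p3 -> path_nbhd v p3 p2 p1 p0.
Proof.
case=> [m [a1 a2 a3] [b1 b2 b3]]; split; last 2 first.
- by split; rewrite sedge_sym.
- by split; rewrite sedge_sym.
by move=> y; rewrite m -mem_rev.
Qed.

Lemma path_nbhd_neq v p0 p1 p2 p3 : path_nbhd v p0 p1 p2 p3 ->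
  [/\ p0 != p2, p0 != p3 & p1 != p3].
Proof.
case=> [m [a1 a2 a3] [b1 b2 b3]]; split.
- by apply: contraTneq a3 => <-.
- by apply: contraTneq a1 => ->; rewrite sedge_sym.
- by apply: contraTneq a1 => ->.
Qed.

Lemma path_nbhd_sedge v p0 p1 p2 p3 : path_nbhd v p0 p1 p2 p3 ->
  [/\ sedge v p0, sedge v p1, sedge v p2 & sedge v p3].
Proof. by move=> pn; split; rewrite (pn_mem pn) !inE eqxx ?orbT. Qed.

Lemma path_nbhd_twist_absurd v b x z a w :
  path_nbhd v b x z a -> path_nbhd z a v x w ->
  forall q0 q1 q2 q3, path_nbhd a q0 q1 q2 q3 -> False.
Proof.
move=> Hv Hz.
have [vb vx vz va] := path_nbhd_sedge Hv.
have [za zv zx zw] := path_nbhd_sedge Hz.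
have [bx xz _] := pn_adj Hv; have [bz ba xa] := pn_nadj Hv.
have [ax aw vw] := pn_nadj Hz.
have common q : sedge a q -> sedge v q -> q = z.
  move=> aq; rewrite (pn_mem Hv) !inE => /or4P[]/eqP eq; subst q => //.
  - by move: aq; rewrite sedge_sym (negbTE ba).
  - by move: aq; rewrite (negbTE ax).
  - by move: aq; rewrite sedge_irrefl.
have key q0 q1 q2 q3 : path_nbhd a q0 q1 q2 q3 -> v \in [:: q0; q1] -> False.
  move=> Ha; have [aq0 aq1 aq2 aq3] := path_nbhd_sedge Ha.
  have [q01 q12 q23] := pn_adj Ha; have [n02 n03 n13] := path_nbhd_neq Ha.
  rewrite !inE => /orP[]/eqP ev; subst.
    have e1 := common _ aq1 q01; subst q1.
    move: q12; rewrite (pn_mem Hz) !inE => /or4P[]/eqP e2; subst q2.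
    - by rewrite sedge_irrefl in aq2.
    - by rewrite eqxx in n02.
    - by rewrite (negbTE ax) in aq2.
    - by rewrite (negbTE aw) in aq2.
  have e0 : q0 = z by apply: common => //; rewrite sedge_sym.
  by rewrite e0 (common _ aq2 q12) eqxx in n02.
move=> q0 q1 q2 q3 Ha; have : sedge a v by rewrite sedge_sym.
rewrite (pn_mem Ha) -[_ :: _]/([:: q0; q1] ++ [:: q2; q3]) mem_cat => /orP[].
  exact: key Ha.
by rewrite -mem_rev; apply: key (path_nbhd_rev Ha).
Qed.

Hypothesis path_nbhds : forall v, exists p0 p1 p2 p3, path_nbhd v p0 p1 p2 p3.

(** One step along the sequence b, x, v, z, a. In N(z) the vertex [v] sees both [x] and [a], so it
    is an inner vertex between them; the order with [a] at the end is excluded by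
    [path_nbhd_twist_absurd]. *)
Lemma path_nbhd_shift v b x z a :
  path_nbhd v b x z a -> exists w, path_nbhd z x v a w.
Proof.
move=> Hv.
have [vb vx vz va] := path_nbhd_sedge Hv.
have [bx xz za] := pn_adj Hv; have [bz ba xa] := pn_nadj Hv.
have [_ _ xna] := path_nbhd_neq Hv.
have key p0 p1 p2 p3 : path_nbhd z p0 p1 p2 p3 -> v \in [:: p0; p1] ->
    exists w, path_nbhd z x v a w.
  move=> Hz; have [a1 a2 a3] := pn_adj Hz; have [n02 n03 n13] := pn_nadj Hz.
  have xp : x \in [:: p0; p1; p2; p3] by rewrite -(pn_mem Hz) sedge_sym.
  have ap : a \in [:: p0; p1; p2; p3] by rewrite -(pn_mem Hz).
  rewrite !inE => /orP[]/eqP ev; subst.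
    have e q : q \in [:: p0; p1; p2; p3] -> sedge p0 q -> q = p1.
      rewrite !inE => /or4P[]/eqP-> //; rewrite ?sedge_irrefl ?(negbTE n02) ?(negbTE n03) //.
    by move: xna; rewrite (e x) // (e a) // eqxx.
  have e q : q \in [:: p0; p1; p2; p3] -> sedge p1 q -> q = p0 \/ q = p2.
    rewrite !inE => /or4P[]/eqP->; rewrite ?sedge_irrefl ?(negbTE n13) //; by [left|right].
  case: (e x xp vx) (e a ap va) => [] ex [] ea; subst x a.
  - by rewrite eqxx in xna.
  - by exists p3.
  - by have [q0 [q1 [q2 [q3]]]] := path_nbhds p0; case/(path_nbhd_twist_absurd Hv Hz).
  - by rewrite eqxx in xna.
have [p0 [p1 [p2 [p3 Hz]]]] := path_nbhds z.
have : sedge z v by rewrite sedge_sym.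
rewrite (pn_mem Hz) -[_ :: _]/([:: p0; p1] ++ [:: p2; p3]) mem_cat => /orP[].
  exact: key Hz.
by rewrite -mem_rev; apply: key (path_nbhd_rev Hz).
Qed.

End PathNbhds.

(** The hypotheses describe the square of a 7-cycle: indices at distance 1 or 2 are adjacent, and
    those at distance 3 are distinct and nonadjacent. The seven vertices are closed under adjacency,
    so they are all of [G]. *)
Lemma path_nbhds_iso_coC7 (G : sgraph) (v0 v1 v2 v3 v4 v5 v6 : G) :
  connected_graph G ->
  path_nbhd v0 v5 v6 v1 v2 -> path_nbhd v1 v6 v0 v2 v3 -> path_nbhd v2 v0 v1 v3 v4 ->
  path_nbhd v3 v1 v2 v4 v5 -> path_nbhd v4 v2 v3 v5 v6 -> path_nbhd v5 v3 v4 v6 v0 ->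
  path_nbhd v6 v4 v5 v0 v1 -> isomorphic G (compl_graph (cycle_graph 7)).
Proof.
move=> Gc H0 H1 H2 H3 H4 H5 H6.
(* Doubling modulo 7 turns the square of the 7-cycle into its complement. *)
pose vs := [:: v0; v4; v1; v5; v2; v6; v3].
have [[_ _ a01 a02] [_ _ a12 a13] [_ _ a23 a24] [_ _ a34 a35]] :=
  And4 (path_nbhd_sedge H0) (path_nbhd_sedge H1) (path_nbhd_sedge H2) (path_nbhd_sedge H3).
have [[_ _ a45 a46] [_ _ a56 a50] [_ _ a60 a61]] :=
  And3 (path_nbhd_sedge H4) (path_nbhd_sedge H5) (path_nbhd_sedge H6).
have [[_ _ n03] [_ _ n14] [_ _ n25] [_ _ n36]] :=
  And4 (pn_nadj H1) (pn_nadj H2) (pn_nadj H3) (pn_nadj H4).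
have [[_ _ n40] [_ _ n51] [_ _ n62]] := And3 (pn_nadj H5) (pn_nadj H6) (pn_nadj H0).
have [[_ _ d03] [_ _ d14] [_ _ d25] [_ _ d36]] :=
  And4 (path_nbhd_neq H1) (path_nbhd_neq H2) (path_nbhd_neq H3) (path_nbhd_neq H4).
have [[_ _ d40] [_ _ d51] [_ _ d62]] :=
  And3 (path_nbhd_neq H5) (path_nbhd_neq H6) (path_nbhd_neq H0).
have uvs : uniq vs.
  rewrite /= !inE !negb_or -!andbA.
  by do ![apply/andP; split=> //]; first [apply: sedge_neq; (assumption || by rewrite sedge_sym)
    | by rewrite eq_sym].
pose h (i : 'I_7) : G := nth v0 vs i.
have hmono (i j : 'I_7) : sedge (h i) (h j) = compl_rel (G := cycle_graph 7) i j.
  have lt (i' j' : 'I_7) : i' < j' ->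
      sedge (h i') (h j') = compl_rel (G := cycle_graph 7) i' j'.
    move=> ij; have ne : i' != j' by apply: contraTneq ij => ->; rewrite ltnn.
    rewrite /compl_rel (ne : (i' : cycle_graph 7) != j').
    rewrite -[sedge (s := cycle_graph 7) _ _]/(cycle_rel i' j') (cycle_relE ij) /h.
    move: (nat_of_ord i') (nat_of_ord j') ij (ltn_ord j') => m k {ne i' j'}.
    case: k => [|[|[|[|[|[|[|k]]]]]]] //; case: m => [|[|[|[|[|[|m]]]]]] //= _ _;
    first [ assumption | by rewrite sedge_sym | by apply/negbTE
          | by apply/negbTE; rewrite sedge_sym ].
  have [ij|ji|/val_inj->] := ltngtP i j; first exact: lt.
    by rewrite sedge_sym lt // compl_sym.
  by rewrite sedge_irrefl compl_irrefl.
have full y : y \in vs.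
  have : y \in [set z in vs] by rewrite (@connected_closed_full _ [set z in vs] v0) ?inE ?eqxx //;
    move=> {}y z; rewrite 2!inE => yv; move: yv;
    rewrite !inE => /orP[/eqP->|/orP[/eqP->|/orP[/eqP->|/orP[/eqP->|/or3P[]/eqP->]]]];
    rewrite (pn_mem H0, pn_mem H1, pn_mem H2, pn_mem H3, pn_mem H4, pn_mem H5, pn_mem H6) !inE;
    by case/or4P=> ->; rewrite ?orbT.
  by rewrite inE.
pose g (y : G) : 'I_7 := inord (index y vs).
have gK : cancel g h by move=> y; rewrite /h /g inordK ?nth_index // -[7]/(size vs) index_mem.
have hK : cancel h g.
  by move=> i; rewrite /g /h (index_uniq v0 (ltn_ord i : i < size vs) uvs) inord_val.
exists g; first by exists h.
by move=> y z; rewrite -[in RHS](gK y) -[in RHS](gK z) hmono.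
Qed.

(** * Path neighbourhoods without a 3-colouring *)

Section FourChromatic.
Variable G : sgraph.
Hypothesis uncolorable : forall f, ~ proper_on 3 [set: G] f.
Hypothesis noHole : ~ hole_in [set: G].
Variables (v : G) (f : G -> nat).
Hypothesis fP : proper_on 3 ([set: G] :\ v) f.
Implicit Types (p q r s u w : G).

Lemma coloring_lt3 u : u != v -> f u < 3.
Proof. by move=> uv; apply: fP.1; rewrite !inE uv. Qed.

Lemma coloring_neq u w : u != v -> w != v -> sedge u w -> f u != f w.
Proof. by move=> uv wv; apply: fP.2; rewrite !inE ?uv ?wv. Qed.

(** Two triangles that share the edge [q r] leave the same third colour for [p] and [s]. *)
Lemma three_coloring_period p q r s : p != v -> q != v -> r != v -> s != v ->
  sedge p q -> sedge p r -> sedge q r -> sedge q s -> sedge r s -> f s = f p.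
Proof.
move=> pv qv rv sv pq pr qr qs rs.
have := And3 (coloring_neq pv qv pq) (coloring_neq pv rv pr) (coloring_neq qv rv qr).
move: (coloring_neq qv sv qs) (coloring_neq rv sv rs).
move: (coloring_lt3 pv) (coloring_lt3 qv) (coloring_lt3 rv) (coloring_lt3 sv).
by move: (f p) (f q) (f r) (f s); clear => i j k l ? ? ? ? ? ? []; lia.
Qed.

Variables (b x z a : G).
Hypothesis Hv : path_nbhd v b x z a.
Hypothesis fab : f a = f b.

(* Otherwise swapping on D would make b and z singly coloured, hence adjacent. *)
Lemma kempe_links_ends (D : {set G}) :
  D \subset bichromatic ([set: G] :\ v) f (f x) (f a) ->
  (forall y y', y \in D -> y' \in bichromatic ([set: G] :\ v) f (f x) (f a) ->
     sedge y y' -> y' \in D) ->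
  b \in D -> a \in D.
Proof.
move=> DB Dcl bD; apply: contraT => aD.
have [vb vx vz va] := path_nbhd_sedge Hv.
have [bx xz za] := pn_adj Hv; have [bz ba xa] := pn_nadj Hv.
have [bv xv zv av] : [/\ b != v, x != v, z != v & a != v].
  by split; rewrite eq_sym sedge_neq.
have fbx := coloring_neq bv xv bx; have fxz := coloring_neq xv zv xz.
have fza := coloring_neq zv av za.
have xD : x \in D by apply: Dcl bD _ bx; rewrite !inE xv eqxx.
have zD : z \notin D.
  apply/negP=> /(subsetP DB); rewrite !inE zv /= => /orP[]/eqP fz.
    by rewrite fz eqxx in fxz.
  by rewrite fz eqxx in fza.
have fP' := kempe_swap_proper fP (coloring_lt3 xv) (coloring_lt3 av) DB Dcl.
(* The swap recolours [b], [x], [z], [a] with [f x], [f b], [f z], [f b]. *)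
pose f' := kempe_swap f (f x) (f a) D.
have f'b : f' b = f x by rewrite /f' /kempe_swap bD (negbTE fbx).
have f'x : f' x = f b by rewrite /f' /kempe_swap xD eqxx.
have f'z : f' z = f z by rewrite /f' /kempe_swap (negbTE zD).
have f'a : f' a = f b by rewrite /f' /kempe_swap (negbTE aD).
rewrite fab in fza.
case/negP: bz; apply: (singly_colored_adj uncolorable noHole (in_setT v) fP'); last first.
- by have [] := path_nbhd_neq Hv.
- split=> [|y]; rewrite in_nbhdT // (pn_mem Hv) !inE.
  by case/or4P=> /eqP->; rewrite -/f' ?f'b ?f'x ?f'z ?f'a // => e;
    move: fbx fxz fza; rewrite e eqxx // eq_sym e eqxx.
- split=> [|y]; rewrite in_nbhdT // (pn_mem Hv) !inE.
  by case/or4P=> /eqP->; rewrite -/f' ?f'b ?f'x ?f'z ?f'a // => e;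
    move: fbx fxz fza; rewrite e eqxx.
Qed.

Hypothesis path_nbhds : forall u : G, exists p0 p1 p2 p3, path_nbhd u p0 p1 p2 p3.

Lemma four_chromatic_iso_coC7 : connected_graph G ->
  isomorphic G (compl_graph (cycle_graph 7)).
Proof.
(* Shifts in both directions give the sequence y, b, x, v, z, a, v3, ..., v7, in which each vertex
   from [x] to [v5] sees the two before and the two after it. *)
move=> Gc; have [v3 H1] := path_nbhd_shift path_nbhds Hv.
have [v4 H2] := path_nbhd_shift path_nbhds H1.
have [v5 H3] := path_nbhd_shift path_nbhds H2.
have [v6 H4] := path_nbhd_shift path_nbhds H3.
have [v7 H5] := path_nbhd_shift path_nbhds H4.
have [y /path_nbhd_rev Hx] := path_nbhd_shift path_nbhds (path_nbhd_rev Hv).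
have [vb vx vz va] := path_nbhd_sedge Hv.
have [_ _ _ z3] := path_nbhd_sedge H1.
have [_ _ a3 a4] := path_nbhd_sedge H2.
have [_ _ e34 e35] := path_nbhd_sedge H3.
have [_ _ e45 e46] := path_nbhd_sedge H4.
have [_ _ e56 e57] := path_nbhd_sedge H5.
have [_ _ e67] := pn_adj H5.
have [bx xz za] := pn_adj Hv; have [bz ba xa] := pn_nadj Hv.
have [bv xv zv av] : [/\ b != v, x != v, z != v & a != v].
  by split; rewrite eq_sym sedge_neq.
have [_ _ dv3] := path_nbhd_neq H1; have [_ dv4 dz4] := path_nbhd_neq H2.
have [_ dz5 da5] := path_nbhd_neq H3; have [_ da6 d36] := path_nbhd_neq H4.
have fbx := coloring_neq bv xv bx; have fxz := coloring_neq xv zv xz.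
have fza := coloring_neq zv av za.
have v3v : v3 != v by rewrite eq_sym.
have v4v : v4 != v by rewrite eq_sym.
(* The uncoloured [v] interrupts the chain of triangles; [f a = f b] makes [x], [z], [a] differently
   coloured, and this restarts it. *)
have f3 : f v3 = f x.
  apply/eqP; move: (coloring_neq zv v3v z3) (coloring_neq av v3v a3) fbx fxz fza; rewrite -fab.
  move: (coloring_lt3 av) (coloring_lt3 xv) (coloring_lt3 zv) (coloring_lt3 v3v).
  by move: (f a) (f x) (f z) (f v3); clear => *; lia.
have f4 : f v4 = f z.
  by apply: (three_coloring_period zv av v3v v4v).
(* As [v3] sees [v5], this gives [v5 != v], so that [v5] is coloured too. *)
have nv3 : ~~ sedge v v3.
  rewrite (pn_mem Hv) !inE !negb_or; apply/and4P; split.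
  - by apply: contraNneq fbx => <-; rewrite f3.
  - by apply: contraTneq a3 => ->; rewrite sedge_sym.
  - by apply: contraTneq z3 => ->; rewrite sedge_irrefl.
  - by apply: contraTneq a3 => ->; rewrite sedge_irrefl.
have v5v : v5 != v by apply: contraNneq nv3 => <-; rewrite sedge_sym.
have f5 : f v5 = f a by apply: (three_coloring_period av v3v v4v v5v).
have nv4 : ~~ sedge v v4.
  rewrite (pn_mem Hv) !inE !negb_or; apply/and4P; split.
  - by apply: contraNneq fza => e; rewrite fab -e f4.
  - by apply: contraNneq fxz => <-; rewrite f4.
  - by rewrite eq_sym.
  - by apply: contraTneq a4 => ->; rewrite sedge_irrefl.
have v6v : v6 != v by apply: contraNneq nv4 => <-; rewrite sedge_sym.
have f6 : f v6 = f x by rewrite -f3; apply: (three_coloring_period v3v v4v v5v v6v).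
have [e5b|d5b] := eqVneq v5 b.
  subst v5.
  have v7E : v7 = v.
    have : sedge b v by rewrite sedge_sym.
    rewrite (pn_mem H5) !inE ![v == _]eq_sym (negbTE v3v) (negbTE v4v) (negbTE v6v) /=.
    by move/eqP.
  have v6E : v6 = x.
    move: bx; rewrite (pn_mem H5) !inE => /or4P[]/eqP ex //; subst; last by rewrite eqxx in xv.
      by rewrite sedge_sym a3 in xa.
    by rewrite f4 eqxx in fxz.
  subst v7 v6.
  have yE : y = v4.
    move: e46; rewrite sedge_sym (pn_mem Hx) !inE => /or4P[]/eqP e4 //; subst.
    - by rewrite -f4 fab eqxx in fza.
    - by rewrite eqxx in v4v.
    - by rewrite eqxx in dz4.
  subst y.
  by apply: path_nbhds_iso_coC7 Gc Hv H1 H2 H3 H4 H5 Hx.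
have v7v : v7 != v.
  apply: contraTneq e57 => ->; rewrite sedge_sym (pn_mem Hv) !inE !negb_or d5b andTb.
  apply/and3P; split; rewrite 1?eq_sym //.
  by apply: contraNneq fbx => ->; rewrite f5 fab.
have f7 : f v7 = f z by rewrite -f4; apply: (three_coloring_period v4v v5v v6v v7v).
have [yb _ _] := pn_adj Hx; have [yv _ _] := path_nbhd_neq Hx.
have [xy _ _ _] := path_nbhd_sedge Hx.
have fyb := coloring_neq yv bv yb; have fxy := coloring_neq xv yv xy.
have x6 : v6 != x.
  apply: contraTneq e56 => ->; rewrite sedge_sym (pn_mem Hx) !inE !negb_or d5b v5v.
  rewrite [v5 == z]eq_sym dz5 !andbT; apply: contraNneq fyb => <-.
  by rewrite f5 fab.
have [_ b_a x_a] := path_nbhd_neq Hv.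
have fax : f a != f x by rewrite fab.
pose B := bichromatic ([set: G] :\ v) f (f x) (f a).
have BE u : (u \in B) = (u != v) && ((f u == f x) || (f u == f a)) by rewrite !inE andbT.
have zB : z \notin B by rewrite BE zv negb_or eq_sym fxz.
have v4B : v4 \notin B by rewrite BE v4v f4 negb_or eq_sym fxz.
have v7B : v7 \notin B by rewrite BE v7v f7 negb_or eq_sym fxz.
have yB : y \notin B by rewrite BE yv negb_or eq_sym fxy fab.
have vB : v \notin B by rewrite BE eqxx.
(* [R] is for the Kempe chain from [b], cut before its final stretch [v5], [v3], [a]. The vertex [x]
   is a dead end: its only neighbour in [B] is [b]. *)
pose R := B :\: [set a; v3; v5; x].
have RE u : (u \in R) = [&& u != a, u != v3, u != v5, u != x & u \in B].
  by rewrite !in_setD !in_setU !in_set1 !negb_or -!andbA.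
(* [T] contains the shortened cycle without [v4]: from [a] through [v] and [b] along the chain to
   [v6]. *)
pose T := (v |: B) :\: [set v3; v5; x].
have TE u : (u \in T) = [&& u != v3, u != v5, u != x & (u == v) || (u \in B)].
  by rewrite !in_setD in_setU1 !in_setU !in_set1 !negb_or -!andbA.
have bR : b \in R.
  rewrite RE b_a [b == v5]eq_sym d5b (sedge_neq bx) BE bv fab eqxx orbT !andbT.
  by apply: contraNneq fbx => ->; rewrite f3.
(* Otherwise [x] and this component form a closed set in [B], since [a] and [v3] have no neighbour
   in [R] and [v5] has at most [v6]. By [kempe_links_ends] that set would contain [a]. *)
have b6 : v6 \in component R b.
  apply: contraT => n6.
  have : a \in x |: component R b.
    apply: kempe_links_ends.
    - apply/subsetP=> u /setU1P[->|]; first by rewrite BE xv eqxx.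
      by rewrite inE RE => /andP[/and5P[]].
    - move=> u u' uD u'B uu'; have [->|u'x] := eqVneq u' x; first by rewrite setU11.
      case/setU1P: uD => [ux|uD].
        rewrite ux (pn_mem Hx) !inE in uu'; case/or4P: uu' => /eqP e; subst u'.
        + by rewrite u'B in yB.
        + by rewrite setU1r // inE bR connect0.
        + by rewrite u'B in vB.
        + by rewrite u'B in zB.
      move: (uD); rewrite inE RE => /andP[/and5P[ua u3 u5 ux uB] _].
      rewrite setU1r //; apply: (component_closed uD _ uu').
      rewrite RE u'x u'B !andbT; apply/and3P; split.
      + apply: contraTneq uu' => ->; rewrite sedge_sym (pn_mem H2) !inE !negb_or u3.
        by apply/and4P; split=> //; apply: contraTneq uB => ->.
      + apply: contraTneq uu' => ->; rewrite sedge_sym (pn_mem H3) !inE !negb_or ua u5.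
        by apply/and4P; split=> //; apply: contraTneq uB => ->.
      + apply: contraTneq uu' => ->; rewrite sedge_sym (pn_mem H5) !inE !negb_or u3.
        apply/and4P; split=> //; try by apply: contraTneq uB => ->.
        by apply: contraNneq n6 => <-.
    - by rewrite setU1r // inE bR connect0.
  rewrite in_setU1 eq_sym (negbTE x_a) inE RE eqxx //.
have RT u : u \in R -> u \in T.
  by rewrite RE TE => /and5P[_ -> -> -> ->]; rewrite orbT.
have vT : v \in T by rewrite TE eqxx ![v == _]eq_sym v3v v5v xv.
have aT : a \in T.
  by rewrite TE BE av eqxx !orbT andbT (sedge_neq a3) da5 eq_sym x_a.
have a6 : connect (induced_rel T) a v6.
  apply: (@connect_trans _ _ v); first by apply: connect1; rewrite /induced_rel /= vT aT sedge_sym.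
  apply: (@connect_trans _ _ b); first by apply: connect1; rewrite /induced_rel /= vT RT.
  move: b6; rewrite inE => /andP[_]; apply: connect_sub => u u' /and3P[uR u'R uu'].
  by apply: connect1; rewrite /induced_rel /= !RT.
have v6N : sedge a v6.
  (* The apex is [v4], which sees only [a] and [v6] in [T]. The vertex [v] joins the side of colour
     [f x], because its neighbours in [T] are [a] and [b]. *)
  apply: (@bipartite_link_adj G setT T v4 a v6 (fun u => (u == v) || (f u == f x))) => //.
  - by rewrite TE (negbTE v4v) (negbTE v4B) !andbF.
  - have gv u : u \in T -> sedge v u -> ~~ ((u == v) || (f u == f x)).
      rewrite TE => /and4P[_ _ ux uvB]; rewrite (pn_mem Hv) !inE => /or4P[]/eqP e; subst u.
      + by rewrite negb_or bv.
      + by rewrite eqxx in ux.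
      + by rewrite (negbTE zv) (negbTE zB) in uvB.
      + by rewrite negb_or av.
    move=> u u' uT u'T uu'.
    have [uv|uv] := eqVneq u v; first by rewrite /= (negbTE (gv u' u'T _)) // -uv.
    have [u'v|u'v] := eqVneq u' v.
      have vu : sedge v u by rewrite -u'v sedge_sym.
      by have := gv u uT vu; rewrite (negbTE uv) => /negbTE->.
    rewrite /=; apply: (bichromatic_bipartite fP (j := f a)) => //.
      by move: uT; rewrite TE (negbTE uv) => /and4P[].
    by move: u'T; rewrite TE (negbTE u'v) => /and4P[].
  - move=> u; rewrite TE => /and4P[u3 u5 _ _].
    by rewrite (pn_mem H4) !inE (negbTE u3) (negbTE u5).
  - by rewrite (negbTE av) (negbTE fax) f6 eqxx orbT.
move: v6N; rewrite (pn_mem H2) !inE (negbTE v6v) [v6 == v3]eq_sym (negbTE d36).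
rewrite [v6 == v4]eq_sym (negbTE (sedge_neq e46)) !orbF => /eqP z6.
by rewrite -f6 z6 eqxx in fxz.
Qed.
End FourChromatic.

(** * Minimal uncolourable sets and conclusion *)

(** A boolean form of [proper_on], for [ex_minset]. The codomain ['I_n.+1] is inhabited even for
    [n = 0], and the bound [f x < n] is imposed on [U] only. *)
Definition colorable_on (G : sgraph) (n : nat) (U : {set G}) : bool :=
  [exists f : {ffun G -> 'I_n.+1},
     [forall x in U, f x < n] &&
     [forall x in U, forall y in U, sedge x y ==> (f x != f y)]].

Lemma colorable_onP (G : sgraph) n (U : {set G}) :
  reflect (exists f, proper_on n U f) (colorable_on n U).
Proof.
apply: (iffP existsP) => [[f /andP[/forall_inP fn /forall_inP fp]]|[f [fn fp]]].
  exists (fun x => nat_of_ord (f x)); split=> // x y xU yU xy.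
  by have /forall_inP/(_ y yU)/implyP/(_ xy) := fp x xU.
exists [ffun x => inord (f x)]; apply/andP; split.
  by apply/forall_inP=> x xU; rewrite ffunE inordK // ?fn // ltnW // ltnS fn.
apply/forall_inP=> x xU; apply/forall_inP=> y yU; apply/implyP=> xy.
by rewrite !ffunE -val_eqE /= !inordK ?fp // ltnS ltnW // fn.
Qed.

Lemma proper_on_colorable (G : sgraph) n f : proper_on n [set: G] f -> colorable G n.
Proof.
case=> fn fp; apply/existsP; exists [ffun x => Ordinal (fn x (in_setT x))].
apply/forallP=> x; apply/forallP=> y; apply/implyP=> xy.
by rewrite !ffunE -val_eqE /= fp.
Qed.

Lemma has_clique_subgraph (G : sgraph) m :
  has_clique G m -> contains_subgraph G (complete_graph m).
Proof.
case=> K Kcl <-; exists (fun i : 'I_#|K| => enum_val i); first exact: enum_val_inj.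
move=> i j ij; apply: Kcl; rewrite ?enum_valP //.
by apply: contra ij => /eqP/enum_val_inj->.
Qed.

Lemma nbhd_degree (G : sgraph) (U : {set G}) v : #|nbhd U v| <= degree v.
Proof. by apply/subset_leq_card/subsetP=> y; rewrite !inE => /andP[]. Qed.

Lemma degree_max (G : sgraph) (v : G) : degree v <= max_degree G.
Proof. exact: leq_bigmax. Qed.

Lemma nbhd_full (G : sgraph) (U : {set G}) v :
  #|nbhd U v| = max_degree G -> forall w, sedge v w -> w \in U.
Proof.
move=> dv w vw; have sub : nbhd U v \subset [set y | sedge v y].
  by apply/subsetP=> y; rewrite !inE => /andP[].
have : nbhd U v == [set y | sedge v y] by rewrite eqEcard sub dv degree_max.
by move/eqP/setP/(_ w); rewrite !inE vw => /andP[].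
Qed.

Theorem theorem2 (G : sgraph) (Gconn : connected_graph G)
    (chi_Delta : chromatic_number G = max_degree G)
    (notC7 : ~ isomorphic G (compl_graph (cycle_graph 7))) :
  contains_subgraph G (complete_graph (max_degree G)) \/ has_high_odd_hole G.
Proof.
case E: (max_degree G) => [|n].
  by left; exists (fun i : 'I_0 => False_rect G (notF (ltn_ord i))) => -[].
have nocol : ~~ colorable G n.
  apply/negP=> Gn; move: chi_Delta; rewrite /chromatic_number E.
  by case: ex_minnP => m _ /(_ n Gn) mn me; rewrite me ltnn in mn.
have [cl|ncl] := classic (has_clique G n.+1); first by left; apply: has_clique_subgraph.
right; apply: NNPP => nhole.
have exU : exists U : {set G}, ~~ colorable_on n U.
  by exists setT; apply: contra nocol => /colorable_onP[f]; apply: proper_on_colorable.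
have [U /minsetP[Ubad Umin]] := ex_minset exU.
have unc f : ~ proper_on n U f.
  by move=> fP; case/negP: Ubad; apply/colorable_onP; exists f.
have crit v : v \in U -> exists f, proper_on n (U :\ v) f.
  move=> vU; apply/colorable_onP; apply: contraT => bad.
  by have := Umin _ bad (subsetDl _ _); move/setP/(_ v); rewrite !inE eqxx vU.
have dge v : v \in U -> n <= #|nbhd U v|.
  by move=> /crit[f fP]; apply: nbhd_card_ge fP.
(* Every vertex of [U] has at least [n], that is Delta - 1, neighbours, so an odd hole inside [U] is
   high. *)
have nhU : ~ hole_in U.
  case=> k [h [hh hU]]; apply: nhole; exists k, h; split=> // i.
  by rewrite E; apply: leq_trans (dge _ (hU i)) (nbhd_degree _ _).
have dU v : v \in U -> #|nbhd U v| = n.+1.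
  move=> vU; apply/eqP; rewrite eqn_leq -{1}E (leq_trans (nbhd_degree _ _) (degree_max _)) /=.
  rewrite ltnNge; apply/negP=> dv; have [f fP] := crit v vU.
  exact/ncl/(low_degree_clique unc nhU vU fP dv).
have [v vU] : exists v, v \in U.
  apply/set0Pn/eqP=> U0; case: (unc (fun=> 0)).
  by split=> x; rewrite U0 inE.
(* Each vertex of [U] has Delta neighbours in [U], hence none outside, and [G] is connected. *)
have UT : U = [set: G].
  apply: (connected_closed_full Gconn vU) => y w yU yw.
  by apply: nbhd_full yw; rewrite dU.
subst U.
have star u : exists a b, double_star [set: G] u a b.
  have [f fP] := crit u (in_setT u).
  have [a [b [ds _]]] :=
    high_degree_double_star unc nhU (in_setT u) fP (dU u (in_setT u)) ncl.
  by exists a, b.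
have deg u : #|nbhd [set: G] u| = n.+1 by apply: dU.
have pn (u : G) : exists p0 p1 p2 p3, path_nbhd u p0 p1 p2 p3.
  have [a [b /(double_star_path_nbhd deg star)[_ [x [z p]]]]] := star u.
  by exists b, x, z, a.
have [f fP] := crit v vU.
have [a [b [ds fab]]] := high_degree_double_star unc nhU vU fP (dU v vU) ncl.
have [n3 [x [z p]]] := double_star_path_nbhd deg star ds; subst n.
exact/notC7/(four_chromatic_iso_coC7 unc nhU fP p fab pn Gconn).
Qed.
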